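(* Let $\boldsymbol g=\nabla_{\boldsymbol z}J(\boldsymbol z^\star;\overline{\boldsymbol\theta})\ne 0$. The global minimizer of the optimization problem $$\min_{\tilde R\in Q}\ \|\tilde R\|_{L^1(\mu)}\qquad\text{subject to}\qquad\nabla_{\boldsymbol z}\tilde R(\boldsymbol z^\star)=-\nabla_{\boldsymbol z}J(\boldsymbol z^\star;\overline{\boldsymbol\theta})$$ is given by $$\tilde R(\boldsymbol z)=\frac{\alpha}{2}\|\boldsymbol g\|_2-(\boldsymbol z-\boldsymbol z^\star)^T\boldsymbol g+\frac12(\boldsymbol z-\boldsymbol z^\star)^T\frac{1}{\alpha\|\boldsymbol g\|_2}\boldsymbol g\boldsymbol g^T(\boldsymbol z-\boldsymbol z^\star).$$
   Context: $J:\mathbb R^m\times\mathbb R^n\to\mathbb R$, $(\boldsymbol z,\boldsymbol\theta)\mapsto J(\boldsymbol z;\boldsymbol\theta)$, is twice continuously differentiable; $\boldsymbol z^\star\in\mathbb R^m$ and $\overline{\boldsymbol\theta}\in\mathbb R^n$ are fixed; $\alpha>0$ is a fixed length scale. The set of candidate updates is $$Q=\{\tilde R:\mathbb R^m\to\mathbb R\ :\ \tilde R\ge 0,\ \tilde R\text{ is quadratic},\ \tilde R\text{ is convex}\},$$ where quadratic means a quadratic polynomial in $\boldsymbol z$. $\mu$ is the Gaussian probability measure on $\mathbb R^m$ with mean $\boldsymbol z^\star$ and covariance matrix $\alpha^2I$, and $\|\tilde R\|_{L^1(\mu)}=\int|\tilde R|\,d\mu$. $\|\cdot\|_2$ is the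 Euclidean norm. *)

(* Defs.v *)
From HB Require Import structures.
From mathcomp Require Import all_boot all_order all_algebra.
From mathcomp Require Import all_classical all_reals all_analysis.

Set Implicit Arguments.
Unset Strict Implicit.
Unset Printing Implicit Defensive.

Import Order.TTheory GRing.Theory Num.Theory.
Import numFieldNormedType.Exports.

Local Open Scope classical_set_scope.
Local Open Scope ring_scope.

(* The sigma-algebra on matrices generated by the entries; on 'cV[R]_m it is
   the Borel sigma-algebra of R^m. *)
Definition measure_mx_display : measure_display -> measure_display.
Proof. exact. Qed.

Section measurable_matrix.
Context d (T : sigmaRingType d) (m n : nat).

Definition mx_cylinders : set (set 'M[T]_(m, n)) :=
  [set B | exists i j, exists2 A : set T,
    measurable A & B = (fun M : 'M[T]_(m, n) => M i j) @^-1` A].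

Let mx_set0 : <<s mx_cylinders >> set0.
Proof. exact: sigma_algebra0. Qed.

Let mx_setC A : <<s mx_cylinders >> A -> <<s mx_cylinders >> (~` A).
Proof. exact: sigma_algebraC. Qed.

Let mx_bigcup (F : (set 'M[T]_(m, n))^nat) :
  (forall i, <<s mx_cylinders >> (F i)) ->
  <<s mx_cylinders >> (\bigcup_i (F i)).
Proof. exact: sigma_algebra_bigcup. Qed.

HB.instance Definition _ := @isMeasurable.Build (measure_mx_display d)
  'M[T]_(m, n) <<s mx_cylinders >> mx_set0 mx_setC mx_bigcup.

End measurable_matrix.

Lemma measurable_mx_entry d (T : sigmaRingType d) m n i j :
  measurable_fun setT (fun M : 'M[T]_(m, n) => M i j).
Proof.
move=> _ A mA; rewrite setTI.
by apply: sub_sigma_algebra; exists i, j, A.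
Qed.

Lemma measurable_fun_mxP d d' (S : measurableType d) (T : measurableType d')
    m n (f : S -> 'M[T]_(m, n)) :
  (forall i j, measurable_fun setT (fun x => f x i j)) ->
  measurable_fun setT f.
Proof.
move=> mf; apply: (@measurability _ _ _ _ _ _ (@mx_cylinders _ T m n)) => //.
move=> _ [_ [i [j [A mA ->]]] <-].
exact: mf.
Qed.

Section isotropic_gaussian.
Context (R : realType).

(* normal_prob lives on measurableTypeR R, which has the same carrier and the
   same measurable sets as R. *)
Definition cons_cV m (p : measurableTypeR R * 'cV[R]_m) : 'cV[R]_m.+1 :=
  \col_i (if unlift 0 i is Some k then p.2 k 0 else p.1).

Lemma measurable_cons_cV m : measurable_fun setT (@cons_cV m).
Proof.
apply: measurable_fun_mxP => i j.
under eq_fun do rewrite mxE.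
case: (unlift 0 i) => [k|]; last exact: measurable_fst.
apply: (@measurableT_comp _ _ _ _ _ _ (fun M : 'cV[R]_m => M k 0)) => //.
exact: measurable_mx_entry.
Qed.

HB.instance Definition _ m := isMeasurableFun.Build _ _ _ _ (@cons_cV m)
  (@measurable_cons_cV m).

(* For s > 0, the Gaussian measure on R^m with mean z and covariance matrix
   (s ^+ 2)%:M: the coordinates are independent, the i-th one with the
   one-dimensional normal law of mean z i 0 and standard deviation s. *)
Fixpoint isotropic_gaussian (s : R) (m : nat) :
    'cV[R]_m -> probability 'cV[R]_m R :=
  match m with
  | 0 => fun=> dirac (0 : 'cV[R]_0) : probability _ R
  | m'.+1 => fun z =>
    let tl := isotropic_gaussian s (row' 0 z : 'cV[R]_m') in
    distribution (normal_prob (z 0%R 0%R) s \x tl)%E (@cons_cV m')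
  end.

Lemma isotropic_gaussian_box s m (z : 'cV[R]_m) (A : 'I_m -> set R) :
  (forall i, measurable (A i)) ->
  isotropic_gaussian s z [set x | forall i, A i (x i 0)] =
  (\prod_(i < m) normal_prob (z i 0%R) s (A i))%E.
Proof.
elim: m z A => [|m IH] z A mA /=.
  rewrite big_ord0 diracE mem_set//; by case.
rewrite big_ord_recl /distribution /pushforward.
rewrite (_ : _ @^-1` _ =
  A ord0 `*` [set x : 'cV[R]_m | forall i, A (lift ord0 i) (x i 0)]).
  rewrite product_measure1E//; last first.
    rewrite (_ : [set x | _] = \bigcap_(i in [set: 'I_m])
      ((fun x : 'cV[R]_m => x i 0) @^-1` A (lift ord0 i))); last first.
      by apply/seteqP; split => x /= H i; [move=> _|]; exact: H.
    apply: fin_bigcap_measurable => // i _.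
    rewrite -[X in measurable X]setTI; exact: measurable_mx_entry.
    exact: mA.
  congr (_ * _)%E.
  transitivity (\prod_(i < m)
      normal_prob (row' 0%R z i 0%R) s (A (lift ord0 i)))%E.
    by apply: (IH (row' 0 z) (fun i => A (lift ord0 i))).
  by apply: eq_bigr => i _; rewrite mxE.
apply/seteqP; split => -[a x] /=.
  move=> H; split; first by have := H ord0; rewrite mxE unlift_none.
  by move=> i; have := H (lift ord0 i); rewrite mxE liftK.
move=> [Aa Ax] i; rewrite mxE.
case: unliftP => [k ->|->] //; exact: Ax.
Qed.

End isotropic_gaussian.

(* Meant for finite-dimensional E, where continuity of all second directional
   derivatives is continuity of the second derivative. *)
Definition twice_continuously_differentiable (R : realType)
    (E : normedModType R) (f : E -> R) : Prop :=
  [/\ forall x, differentiable f x,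
      forall v x, differentiable ('D_v f) x
    & forall v w, continuous ('D_w ('D_v f))].

Section candidates.
Context (R : realType) (m : nat).
Implicit Types (f : 'cV[R]_m -> R) (z : 'cV[R]_m).

Definition gradient f z : 'cV[R]_m :=
  \col_i ('D_(delta_mx i 0) f z : R).

(* The library norm `|v| on matrices is the sup norm. *)
Definition norm2 (v : 'cV[R]_m) : R := Num.sqrt (\sum_i v i 0 ^+ 2).

(* Polynomial of total degree at most 2. *)
Definition quadratic f : Prop :=
  exists (A : 'M[R]_m) (b : 'cV[R]_m) (c : R),
    forall z, f z = (z^T *m A *m z) 0 0 + (b^T *m z) 0 0 + c.

Definition candidate_updates : set ('cV[R]_m -> R) :=
  [set f | [/\ forall z, 0 <= f z, quadratic f & convex_function setT f]].

Definition L1_norm (mu : {measure set 'cV[R]_m -> \bar R}) f : \bar R :=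
  'N[mu]_1[EFin \o f].

End candidates.

(* x is the only point of S at which F attains its minimum over S. *)
Definition unique_global_minimizer (R : realType) (T : Type) (S : set T)
    (F : T -> \bar R) (x : T) : Prop :=
  [/\ S x, forall y, S y -> (F x <= F y)%E
    & forall y, S y -> (forall y', S y' -> (F y <= F y')%E) -> y = x].

(* Main.v *)
(* Write a candidate as R(z* + x) = c - g.x + x^T A x with A symmetric, and let
   h = g^T A g / |g|^2.  Nonnegativity of R on the line z* + t g forces
   |g|^2 <= 4 c h, and nonnegativity on all lines forces A to be positive
   semidefinite, so that h <= tr A.  Since R >= 0, its L^1 norm is its Gaussian
   mean c + alpha^2 tr A >= c + alpha^2 h >= 2 alpha sqrt(c h) >= alpha |g|.
   Equality forces c = alpha^2 h, and h = tr A means that A vanishes on the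
   orthogonal complement of g, so that A is a multiple of g g^T. *)
Require Import Defs.
From mathcomp Require Import all_boot all_order all_algebra.
From mathcomp Require Import all_classical all_reals all_analysis.
From mathcomp Require Import measurable_realfun ring lra.

Set Implicit Arguments.
Unset Strict Implicit.
Unset Printing Implicit Defensive.

Import Order.TTheory GRing.Theory Num.Theory.
Import numFieldNormedType.Exports.

Local Open Scope classical_set_scope.
Local Open Scope ring_scope.

(** * Gaussian integrals of nonnegative quadratic functions of one variable *)

Section gaussian_quadratic.
Context {R : realType}.
Local Notation leb := (@lebesgue_measure R).
Import gauss_integral_proof.

(** The line is split at 0 and the negative half reflected by [x -> - x]. The odd part of [f] then
    cancels pointwise, so no integrability has to be checked. *)
Lemma ge0_integralT_fold (f : R -> R) :
  (forall x, 0 <= f x) -> continuous f ->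
  (\int[leb]_x (f x)%:E = \int[leb]_(x in `[0%R, +oo[) (f x + f (- x))%:E)%E.
Proof.
move=> f0 cf.
have mf : measurable_fun [set: R] f by exact: continuous_measurable_fun.
have cfN : continuous (f \o -%R).
  by move=> x; apply: continuous_comp; [exact: continuousN|exact: cf].
have mfN : measurable_fun [set: R] (f \o -%R).
  exact: continuous_measurable_fun.
rewrite -(setUv `[0%R, +oo[%classic) ge0_integral_setU//= ; last 4 first.
- exact: measurableC.
- by apply/measurable_EFinP; rewrite setUv.
- by move=> x _; rewrite lee_fin.
- exact/disj_setPCl.
rewrite setCitvr integral_itv_bndo_bndc; last first.
  exact/measurable_EFinP/measurable_funTS.
have := @ge0_integration_by_substitutionNy R f 0.
rewrite oppr0 => ->//; last first.
  exact: continuous_subspaceT.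
under [RHS]eq_integral do rewrite EFinD.
rewrite ge0_integralD//=.
- by move=> x _; rewrite lee_fin.
- exact/measurable_EFinP/measurable_funTS.
- by move=> x _; rewrite lee_fin.
- exact/measurable_EFinP/measurable_funTS.
Qed.

(** This is the first fundamental theorem of calculus on [[0, x + 1]], an interval having [x] in its
    interior. *)
Lemma derive_integral0_gauss (x : R) : 0 < x ->
  is_derive x 1 (@integral0_gauss R) (gauss_fun x).
Proof.
move=> x0.
have [d e] : derivable (@integral0_gauss R) x 1 /\
    derive1 (@integral0_gauss R) x = gauss_fun x.
  apply: (@continuous_FTC1 R gauss_fun (BLeft 0) _ (x + 1) _ _ _ _).
  - by rewrite ltrDl.
  - apply: continuous_compact_integrable => //; first exact: segment_compact.
    by apply: continuous_subspaceT; exact: continuous_gauss_fun.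
  - by rewrite /=; rewrite lte_fin.
  - by move=> ?; exact: continuous_gauss_fun.
by apply: (DeriveDef d); rewrite -derive1E.
Qed.

(** The square of this nonnegative primitive tends to [pi / 4]; take square roots. *)
Lemma cvg_integral0_gauss :
  @integral0_gauss R x @[x --> +oo] --> Num.sqrt pi / 2.
Proof.
have : Num.sqrt (@integral0_gauss R x ^+ 2) @[x --> +oo]
    --> Num.sqrt (pi / 4).
  apply: continuous_cvg => //;
    [exact: sqrt_continuous|exact: cvg_integral0_gauss_sqr].
rewrite sqrtrM ?pi_ge0// sqrtrV// (_ : 4 = 2 ^+ 2); last first.
  by rewrite expr2 -natrM.
rewrite sqrtr_sqr ger0_norm//.
rewrite (_ : (fun _ => Num.sqrt _) = integral0_gauss)//.
apply/funext => r; rewrite sqrtr_sqr// ger0_norm//.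
exact: integral0_gauss_ge0.
Qed.

Lemma integral0_gauss_cvg0 :
  @integral0_gauss R x @[x --> 0^'+] --> @integral0_gauss R 0.
Proof.
have : {within `[0, 1], continuous @integral0_gauss R}.
  apply: parameterized_integral_continuous => //=.
  apply: continuous_compact_integrable => //; first exact: segment_compact.
  by apply: continuous_subspaceT; exact: continuous_gauss_fun.
by move/continuous_within_itvP => /(_ ltr01)[].
Qed.

(** Squeeze between 0 and [x^-1]: for [x > 0], [x ^+ 2 <= 1 + x ^+ 2 <= expR (x ^+ 2)]. *)
Lemma cvg_id_gauss_fun : x * gauss_fun x @[x --> +oo%R] --> (0 : R).
Proof.
apply: (@squeeze_cvgr _ _ _ _ (cst 0) (fun x : R => x^-1)).
- near=> x; have x0 : 0 < x by near: x; exact: nbhs_pinfty_gt.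
  rewrite mulr_ge0 ?gauss_fun_ge0 ?(ltW x0)//=.
  rewrite -(@ler_pM2l _ x)// mulrA -expr2 divff ?gt_eqF//.
  rewrite /gauss_fun expRN ler_pdivrMr ?expR_gt0// mul1r.
  by apply: le_trans (expR_ge1Dx _); rewrite lerDr.
- exact: cvg_cst.
- by apply/gtr0_cvgV0; [exact: nbhs_pinfty_gt|exact: cvg_id].
Unshelve. all: end_near. Qed.

(* The linear term is removed by folding the line at 0; an antiderivative of the
   even part is then (2 a + c) G(x) - c x exp(-x^2), where G is the primitive
   of exp(-x^2) vanishing at 0. *)
Lemma integral_quadratic_gauss_fun (a b c : R) :
  (forall x, 0 <= a + b * x + c * x ^+ 2) ->
  (\int[leb]_x ((a + b * x + c * x ^+ 2) * gauss_fun x)%:E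
   = ((a + c / 2) * Num.sqrt pi)%:E)%E.
Proof.
move=> f0.
have cq (p q r : R) :
    continuous (fun x => (p + q * x + r * x ^+ 2) * gauss_fun x).
  move=> x; apply: cvgM; last exact: continuous_gauss_fun.
  apply: cvgD; last by apply: cvgM; [exact: cvg_cst|exact: exprn_continuous].
  by apply: cvgD; [exact: cvg_cst|apply: cvgM; [exact: cvg_cst|exact: cvg_id]].
rewrite ge0_integralT_fold//; last first.
  by move=> x; rewrite mulr_ge0 ?gauss_fun_ge0.
under eq_integral => x _.
  rewrite [X in X%:E](_ : _ =
      (a *+ 2 + 0 * x + c *+ 2 * x ^+ 2) * gauss_fun x); last first.
    by rewrite /gauss_fun sqrrN; ring.
  over.
pose F := fun x : R => (a *+ 2 + c) * integral0_gauss x - c * (x * gauss_fun x).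
rewrite (@ge0_continuous_FTC2y _ _ F 0
  ((a *+ 2 + c) * (Num.sqrt pi / 2) - c * 0)).
- rewrite -EFinB /F /integral0_gauss set_itv1 Rintegral_set1; congr EFin.
  by field.
- move=> x _; rewrite mulr_ge0 ?gauss_fun_ge0//.
  have := f0 x; have := f0 (- x); rewrite sqrrN; lra.
- exact: continuous_subspaceT.
- apply: cvgB.
    by apply: cvgM; [exact: cvg_cst|exact: cvg_integral0_gauss].
  by apply: cvgM; [exact: cvg_cst|exact: cvg_id_gauss_fun].
- move=> x x0; have := derive_integral0_gauss x0 => ?.
  rewrite /F /gauss_fun; exact: ex_derive.
- apply: cvgB.
    by apply: cvgM; [exact: cvg_cst|exact: integral0_gauss_cvg0].
  apply: cvgM; [exact: cvg_cst|].
  apply: cvg_at_right_filter.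
  by apply: cvgM; [exact: cvg_id|exact: continuous_gauss_fun].
- move=> x; rewrite in_itv/= andbT => x0.
  have := derive_integral0_gauss x0 => ?.
  rewrite derive1E /F /gauss_fun derive_val /GRing.scale/= /gauss_fun; ring.
Qed.

End gaussian_quadratic.

(** * Quadratic moments of the one-dimensional normal law *)

Section normal_quadratic.
Context {R : realType}.
Local Notation leb := (@lebesgue_measure R).

(** The Radon-Nikodym derivative of the normal law agrees almost everywhere with [normal_pdf], as
    both have the same integral over every measurable set. *)
Lemma ge0_integral_normal_prob (m s : R) (f : R -> \bar R) :
  measurable_fun [set: R] f -> (forall x, 0 <= f x)%E ->
  (\int[normal_prob m s]_x f x = \int[leb]_x (f x * (normal_pdf m s x)%:E))%E.
Proof.
move=> mf f0.
have dom := @normal_prob_dominates R m s.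
rewrite -(Radon_Nikodym_SigmaFinite.change_of_variables dom)//.
have iRN := Radon_Nikodym_SigmaFinite.f_integrable dom.
apply: ae_eq_integral => //.
- by apply: emeasurable_funM => //; exact: measurable_int iRN.
- apply: emeasurable_funM => //.
  by apply/measurable_EFinP; exact: measurable_normal_pdf.
- apply: ae_eqe_mul2l; apply: integral_ae_eq => //.
  + by apply/measurable_EFinP; exact: measurable_normal_pdf.
  + by move=> A _ mA; rewrite -Radon_Nikodym_SigmaFinite.f_integral.
Qed.

Lemma integral_quadratic_normal_prob (m s a b c : R) : 0 < s ->
  (forall x, 0 <= a + b * (x - m) + c * (x - m) ^+ 2) ->
  (\int[normal_prob m s]_x (a + b * (x - m) + c * (x - m) ^+ 2)%:E
   = (a + c * s ^+ 2)%:E)%E.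
Proof.
move=> s0 f0.
rewrite ge0_integral_normal_prob; last 2 first.
- apply/measurable_EFinP; apply: measurable_funD.
    apply: measurable_funD => //; apply: measurable_funM => //.
    exact: measurable_funB.
  apply: measurable_funM => //; apply: measurable_funX.
  exact: measurable_funB.
- by move=> x; rewrite lee_fin.
(* The substitution [y = (x - m) / r] with this [r] turns the exponent of the normal density into
   [- y ^+ 2]; the factor 1/2 of the second moment then cancels in [c * r ^+ 2 / 2 = c * s ^+ 2]. *)
pose r := Num.sqrt 2 * s.
have r0 : 0 < r by rewrite mulr_gt0// sqrtr_gt0.
have r2 : r ^+ 2 = s ^+ 2 *+ 2 by rewrite exprMn sqr_sqrtr// mulr_natl.
have pi0 : 0 < Num.sqrt (pi : R) by rewrite sqrtr_gt0 pi_gt0.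
pose F x := (x - m) / r.
have dF : derive1 F = cst r^-1.
  by apply/funext => x; rewrite derive1E /F derive_val /GRing.scale/=; ring.
have f0' x : 0 <= a + (b * r) * x + (c * r ^+ 2) * x ^+ 2.
  by have := f0 (r * x + m); rewrite addrK exprMn !mulrA.
pose G x :=
  (Num.sqrt pi)^-1 * ((a + (b * r) * x + (c * r ^+ 2) * x ^+ 2) * gauss_fun x).
transitivity (\int[leb]_x (G x)%:E)%E; last first.
  under eq_integral do rewrite EFinM.
  rewrite ge0_integralZl//=.
  - rewrite integral_quadratic_gauss_fun// -EFinM r2; congr EFin.
    by field; rewrite gt_eqF.
  - apply/measurable_EFinP; apply: measurable_funM => //; last first.
      exact: measurable_gauss_fun.
    apply: measurable_funD; last first.
      by apply: measurable_funM => //; exact: measurable_funX.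
    by apply: measurable_funD => //; exact: measurable_funM.
  - by move=> x _; rewrite lee_fin mulr_ge0 ?gauss_fun_ge0.
rewrite (@increasing_ge0_integration_by_substitutionT _ F G).
- apply: eq_integral => x _; rewrite -EFinM dF normal_pdfE ?gt_eqF//.
  congr EFin; transitivity (G (F x) / r) => //.
  rewrite /G /F /normal_peak /normal_fun /gauss_fun.
  have -> : - ((x - m) / r) ^+ 2 = - (x - m) ^+ 2 / (s ^+ 2 *+ 2).
    by rewrite exprMn exprVn r2 mulNr.
  have -> : Num.sqrt (s ^+ 2 * pi *+ 2) = r * Num.sqrt pi.
    rewrite -mulrnAl -r2 sqrtrM ?sqr_ge0// sqrtr_sqr ger0_norm//; exact: ltW.
  field; rewrite ?gt_eqF//.
- by move=> x y xy; rewrite /F ltr_pM2r ?invr_gt0// ltrD2r.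
- by rewrite dF => x; exact: cvg_cst.
- by rewrite dF; exact: is_cvg_cst.
- by rewrite dF; exact: is_cvg_cst.
- by move=> x; rewrite /F; exact: ex_derive.
- by apply/gt0_cvgMlNy; [rewrite invr_gt0|exact: cvg_addrr_Ny].
- by apply/gt0_cvgMly; [rewrite invr_gt0|exact: cvg_addrr].
- move=> x; apply: cvgM; [exact: cvg_cst|].
  apply: cvgM; last exact: continuous_gauss_fun.
  apply: cvgD; last by apply: cvgM; [exact: cvg_cst|exact: exprn_continuous].
  by apply: cvgD; [exact: cvg_cst|apply: cvgM; [exact: cvg_cst|exact: cvg_id]].
- by move=> x; rewrite !mulr_ge0 ?gauss_fun_ge0// invr_ge0 ltW.
Qed.

End normal_quadratic.

(** * Quadratic functions of several variables *)

Section quadratic_functions.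
Context {R : realType} {m : nat}.
Implicit Types (x y b : 'cV[R]_m) (A : 'M[R]_m) (c : R).

Definition dot x y : R := (x^T *m y) 0 0.

Lemma dotE x y : dot x y = \sum_i x i 0 * y i 0.
Proof. by rewrite /dot mxE; apply: eq_bigr => i _; rewrite mxE. Qed.

Lemma dotC x y : dot x y = dot y x.
Proof. by rewrite !dotE; apply: eq_bigr => i _; rewrite mulrC. Qed.

Lemma dot0r x : dot x 0 = 0.
Proof. by rewrite /dot mulmx0 mxE. Qed.

Lemma dotDr x y z : dot x (y + z) = dot x y + dot x z.
Proof. by rewrite /dot mulmxDr mxE. Qed.

Lemma dotZr x a y : dot x (a *: y) = a * dot x y.
Proof. by rewrite /dot -scalemxAr mxE. Qed.

Lemma dotDl x y z : dot (x + y) z = dot x z + dot y z.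
Proof. by rewrite !(dotC _ z) dotDr. Qed.

Lemma dotZl a x y : dot (a *: x) y = a * dot x y.
Proof. by rewrite !(dotC _ y) dotZr. Qed.

Lemma dotNl x y : dot (- x) y = - dot x y.
Proof. by rewrite -scaleN1r dotZl mulN1r. Qed.

Lemma dot_mulmx x A y : dot x (A *m y) = dot (A^T *m x) y.
Proof. by rewrite /dot trmx_mul trmxK mulmxA. Qed.

Lemma dot_delta b i : dot b (delta_mx i 0) = b i 0.
Proof.
rewrite dotE (bigD1 i)//= mxE !eqxx mulr1 big1 ?addr0// => j ji.
by rewrite mxE (negbTE ji) mulr0.
Qed.

Lemma mulmx_col_row x y z : x *m y^T *m z = dot y z *: x.
Proof.
by rewrite -mulmxA [y^T *m z]mx11_scalar mul_mx_scalar.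
Qed.

Lemma dot_eq0 x : dot x x = 0 -> x = 0.
Proof.
rewrite dotE => /psumr_eq0P x0; apply/colP => i; rewrite mxE.
apply/eqP; rewrite -[_ == _]orbb -mulf_eq0; apply/eqP/x0 => // j _.
by rewrite -expr2 sqr_ge0.
Qed.

Lemma sqr_norm2 x : norm2 x ^+ 2 = dot x x.
Proof.
rewrite sqr_sqrtr; last by apply: sumr_ge0 => i _; exact: sqr_ge0.
by rewrite dotE; apply: eq_bigr => i _; rewrite expr2.
Qed.

Lemma norm2_gt0 x : x <> 0 -> 0 < norm2 x.
Proof.
move=> x0; rewrite lt_neqAle sqrtr_ge0 andbT; apply/eqP => n0.
by apply: x0; apply: dot_eq0; rewrite -sqr_norm2 -n0 expr0n.
Qed.

(** There is no factor 1/2 on the last term: for symmetric [A] the Hessian is [2 A]. *)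
Definition quad c b A x : R := c + dot b x + dot x (A *m x).

Lemma quad_shift c b A x y :
  quad c b A (x + y) = quad (quad c b A y) (b + (A + A^T) *m y) A x.
Proof.
rewrite /quad mulmxDr mulmxDl !(dotDr, dotDl).
rewrite [dot (A *m y) x]dotC [dot (A^T *m y) x]dotC.
rewrite [dot y (A *m x)]dot_mulmx [dot (A^T *m y) x]dotC; ring.
Qed.

Lemma quad_sym c b A x : quad c b A x = quad c b (2^-1 *: (A + A^T)) x.
Proof.
rewrite /quad -scalemxAl mulmxDl dotZr dotDr [dot x (A^T *m x)]dot_mulmx trmxK.
by rewrite (dotC (A *m x)); field.
Qed.

(** Normal form of a candidate: expanded at [z0], with the matrix replaced by its symmetric part. *)
Lemma quadraticP (f : 'cV[R]_m -> R) z0 : quadratic f ->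
  exists c b A, A^T = A /\ forall z, f z = quad c b A (z - z0).
Proof.
case=> A [b [c fE]].
exists (quad c b A z0), (b + (A + A^T) *m z0), (2^-1 *: (A + A^T)).
split; first by rewrite linearZ linearD/= trmxK addrC.
move=> z; rewrite -quad_sym -quad_shift subrK fE /quad /dot -mulmxA; ring.
Qed.

Lemma quadratic_quad c b A z0 : quadratic (fun z => quad c b A (z - z0)).
Proof.
exists A, (b + (A + A^T) *m (- z0)), (quad c b A (- z0)) => z.
by rewrite quad_shift /quad /dot -mulmxA; ring.
Qed.

(** For [h != 0] the difference quotient is exactly [dot b v + h * dot v (A *m v)]. *)
Lemma derive_quad c b A z0 v :
  'D_v (fun z => quad c b A (z - z0)) z0 = dot b v.
Proof.
rewrite /derive; apply: cvg_lim => //.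
have : dot b v + h * dot v (A *m v) @[h --> (0 : R)^'] --> dot b v.
  rewrite -[X in _ --> X]addr0 -[X in _ --> _ + X](mul0r (dot v (A *m v))).
  apply: cvgD; first exact: cvg_cst.
  apply: cvgM; last exact: cvg_cst.
  exact: nbhs_dnbhs.
apply: cvg_trans; apply: near_eq_cvg.
near=> h; have h0 : h != 0 by near: h; exact: nbhs_dnbhs_neq.
rewrite /= addrK subrr /quad mulmx0 !dot0r -scalemxAr !dotZr !dotZl.
rewrite /GRing.scale/=; field.
Unshelve. all: by end_near. Qed.

Lemma gradient_quad c b A z0 :
  gradient (fun z => quad c b A (z - z0)) z0 = b.
Proof. by apply/colP => i; rewrite mxE derive_quad dot_delta. Qed.

End quadratic_functions.

(** * Nonnegativity, semidefiniteness and convexity *)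

Lemma ge0_quadratic_discr {R : realType} (a b c : R) :
  (forall t, 0 <= a + b * t + c * t ^+ 2) -> 0 <= c /\ b ^+ 2 <= 4 * a * c.
Proof.
move=> f0.
have a0 : 0 <= a by have := f0 0; rewrite mulr0 expr0n mulr0 !addr0.
have c0 : 0 <= c.
  rewrite leNgt; apply/negP => c0.
  (* If [c < 0], then [t >= 1] and [c * t = c - (a + 1)], so the values at [t] and [- t] have mean
     [a + (c - (a + 1)) * t <= c - 1 < 0]. *)
  pose t := 1 - (a + 1) / c.
  have ct : c * t = c - (a + 1) by rewrite /t; field; rewrite lt_eqF.
  have t1 : 1 <= t.
    by rewrite lerBrDl addrC -lerBrDl subrr nmulr_lle0 ?invr_lt0//; lra.
  have := f0 t; have := f0 (- t); rewrite sqrrN expr2 mulrA ct; nra.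
split=> //; have [c1|c1] := eqVneq c 0.
  have [->|b0] := eqVneq b 0; first by rewrite c1 expr0n mulr0.
  (* A nonconstant affine function takes the value -1 at this point. *)
  have := f0 (- (a + 1) / b); rewrite c1 mul0r addr0 mulrCA divff// mulr1; lra.
have cp : 0 < c by rewrite lt_neqAle eq_sym c1.
(* The vertex of the parabola, where the value is [(4 * a * c - b ^+ 2) / (4 * c)]. *)
have := f0 (- b / (2 * c)).
rewrite (_ : _ + _ = (4 * a * c - b ^+ 2) / (4 * c)); last by field.
by rewrite pmulr_lge0 ?invr_gt0 ?mulr_gt0// subr_ge0.
Qed.

(** On the line [t *: x] the function is a scalar quadratic with leading coefficient
    [dot x (A *m x)]. *)
Lemma quad_ge0_psd {R : realType} {m : nat} c (b : 'cV[R]_m) A :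
  (forall x, 0 <= quad c b A x) -> forall x, 0 <= dot x (A *m x).
Proof.
move=> q0 x; apply: (@ge0_quadratic_discr _ c (dot b x) _ _).1 => t.
have := q0 (t *: x); rewrite /quad -scalemxAr !(dotZl, dotZr).
by congr (_ <= _); ring.
Qed.

Lemma convex_quad {R : realType} {m : nat} c (b : 'cV[R]_m) A z0 :
  (forall x, 0 <= dot x (A *m x)) ->
  convex_function setT (fun z => quad c b A (z - z0)).
Proof.
move=> A0 t x y _ _.
change (quad c b A (t%:num *: (x : 'cV[R]_m) + (1 - t%:num) *: (y : 'cV[R]_m) - z0)
  <= t%:num * quad c b A (x - z0) + (1 - t%:num) * quad c b A (y - z0)).
set p : R := t%:num.
have -> : p *: (x : 'cV[R]_m) + (1 - p) *: (y : 'cV[R]_m) - z0 =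
    p *: (x - z0) + (1 - p) *: (y - z0).
  by apply/colP => i; rewrite !mxE; ring.
set u := x - z0; set v := y - z0; clearbody u v.
(* The constant and linear terms drop out of the convexity gap, which is a multiple of the quadratic
   form at [u - v]. *)
rewrite -subr_ge0 (_ : _ - _ = p * (1 - p) * dot (u - v) (A *m (u - v))).
  by apply: mulr_ge0 (A0 _); apply: mulr_ge0; rewrite /p ?subr_ge0.
rewrite /quad -[u - v]/(u + - v) -scaleN1r !mulmxDr -!scalemxAr.
rewrite !(dotDl, dotDr) !(dotZl, dotZr); ring.
Qed.

(** * Gaussian mean of a nonnegative quadratic function of several variables *)

Section isotropic_gaussian_quad.
Context {R : realType}.

Lemma cons_cVB m (t : R) (y : 'cV[R]_m) (z : 'cV[R]_m.+1) :
  cons_cV (t, y) - z = cons_cV (t - z 0 0, y - row' 0 z).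
Proof.
apply/colP => i; rewrite !mxE.
by case: unliftP => [k ->|->]; rewrite ?mxE.
Qed.

Lemma dot_cons_cV m (b : 'cV[R]_m.+1) (t : R) (y : 'cV[R]_m) :
  dot b (cons_cV (t, y)) = b 0 0 * t + dot (row' 0 b) y.
Proof.
rewrite !dotE big_ord_recl mxE unlift_none; congr (_ + _).
by apply: eq_bigr => i _; rewrite !mxE liftK.
Qed.

Lemma mulmx_cons_cV m n (A : 'M[R]_(n, m.+1)) (t : R) (y : 'cV[R]_m) :
  A *m cons_cV (t, y) = t *: col 0 A + col' 0 A *m y.
Proof.
apply/colP => i; rewrite !mxE big_ord_recl mxE unlift_none mulrC; congr (_ + _).
by apply: eq_bigr => k _; rewrite !mxE liftK.
Qed.

(** Freezing the first coordinate leaves a [quad] in the others, whose matrix does not depend on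
    [t]. This drives the induction on the dimension. *)
Lemma quad_cons_cV m c (b : 'cV[R]_m.+1) A (t : R) (y : 'cV[R]_m) :
  quad c b A (cons_cV (t, y)) =
  quad (c + b 0 0 * t + A 0 0 * t ^+ 2)
    (row' 0 b + t *: (row' 0 (col 0 A) + (col' 0 (row 0 A))^T))
    (row' 0 (col' 0 A)) y.
Proof.
rewrite /quad dot_cons_cV [dot (cons_cV _) _]dotC dot_cons_cV.
have -> : (A *m cons_cV (t, y)) 0 0 = t * A 0 0 + dot (col' 0 (row 0 A))^T y.
  rewrite mulmx_cons_cV !mxE dotE; congr (_ + _).
  by apply: eq_bigr => k _; rewrite !mxE.
have -> : row' 0 (A *m cons_cV (t, y)) =
    t *: row' 0 (col 0 A) + row' 0 (col' 0 A) *m y.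
  rewrite mulmx_cons_cV; apply/colP => i; rewrite !mxE; congr (_ + _).
  by apply: eq_bigr => k _; rewrite !mxE.
rewrite [dot y _]dotC !(dotDl, dotZl); ring.
Qed.

Lemma measurable_quad m c (b : 'cV[R]_m) A (z : 'cV[R]_m) :
  measurable_fun [set: 'cV[R]_m] (fun x => quad c b A (x - z)).
Proof.
have mB i : measurable_fun [set: 'cV[R]_m] (fun x : 'cV[R]_m => (x - z) i 0).
  under eq_fun do rewrite !mxE.
  by apply: measurable_funB => //; exact: measurable_mx_entry.
rewrite /quad; apply: measurable_funD; first apply: measurable_funD => //.
  under eq_fun do rewrite dotE.
  by apply: measurable_sum => i; apply: measurable_funM.
under eq_fun do rewrite dotE.
apply: measurable_sum => i; apply: measurable_funM => //.
under eq_fun do rewrite mxE.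
by apply: measurable_sum => j; apply: measurable_funM.
Qed.

(** Induction on [m] by Tonelli: the inner integral removes the linear term, cross terms included,
    and leaves a scalar quadratic in the first coordinate. *)
Lemma integral_quad_isotropic_gaussian (s : R) m (z : 'cV[R]_m) c b A :
  0 < s -> (forall x, 0 <= quad c b A x) ->
  (\int[isotropic_gaussian s z]_x (quad c b A (x - z))%:E =
   (c + s ^+ 2 * \tr A)%:E)%E.
Proof.
move=> s0; elim: m z c b A => [|m IH] z c b A q0 /=.
  rewrite integral_dirac//; last by apply/measurable_EFinP; exact: measurable_quad.
  rewrite diracT mul1e /quad /dot /mxtrace !big_ord0 !mxE !big_ord0.
  by rewrite mulr0 !addr0.
have q0' t y := q0 (cons_cV (t, y)).
rewrite ge0_integral_distribution; last 2 first.
- by apply/measurable_EFinP; exact: measurable_quad.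
- by move=> x; rewrite lee_fin.
rewrite fubini_tonelli1/=; last 2 first.
- apply: measurableT_comp; last exact: measurable_cons_cV.
  by apply/measurable_EFinP; exact: measurable_quad.
- by move=> x; rewrite lee_fin.
pose A' := row' 0 (col' 0 A).
have inner (t : R) : (\int[isotropic_gaussian s (row' 0%R z : 'cV[R]_m)]_y
    (quad c b A (cons_cV (t, y) - z))%:E =
    ((c + s ^+ 2 * \tr A') + b 0 0 * (t - z 0 0) + A 0 0 * (t - z 0 0) ^+ 2)%:E)%E.
  under eq_integral do rewrite cons_cVB quad_cons_cV.
  rewrite IH; first by congr EFin; rewrite /A'; ring.
  by move=> y; rewrite -quad_cons_cV.
rewrite /fubini_F; under eq_integral do rewrite inner.
(* The scalar quadratic is nonnegative because it is itself an integral of a nonnegative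
   function. *)
rewrite integral_quadratic_normal_prob//; last first.
  move=> t; rewrite -lee_fin -inner integral_ge0// => y _.
  by rewrite lee_fin.
congr EFin; have -> : \tr A = A 0 0 + \tr A'.
  rewrite /mxtrace big_ord_recl; congr (_ + _).
  by apply: eq_bigr => i _; rewrite !mxE.
ring.
Qed.

End isotropic_gaussian_quad.

(** * Trace and Rayleigh quotient *)

Section positive_semidefinite.
Context {R : realType} {m : nat}.
Variables (A : 'M[R]_m).
Hypothesis symA : A^T = A.
Hypothesis A0 : forall x, 0 <= dot x (A *m x).

(** With [v = A *m w], the form at [w + t *: v] is [2 * dot v v * t + dot v (A *m v) * t ^+ 2];
    having no constant term, it stays nonnegative only if [dot v v = 0]. *)
Lemma psd_mulmx_eq0 w : dot w (A *m w) = 0 -> A *m w = 0.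
Proof.
move=> w0; apply: dot_eq0; set v := A *m w.
have := @ge0_quadratic_discr _ 0 (2 * dot v v) (dot v (A *m v)).
case.
  move=> t; have := A0 (w + t *: v).
  rewrite mulmxDr -scalemxAr !(dotDl, dotDr) !(dotZl, dotZr) w0.
  by rewrite [dot w (A *m v)]dot_mulmx symA -/v; congr (_ <= _); ring.
move=> _; rewrite mulr0 mul0r => vv.
have : (2 * dot v v) ^+ 2 == 0 by rewrite eq_le vv sqr_ge0.
by rewrite sqrf_eq0 mulf_eq0 pnatr_eq0/= => /eqP.
Qed.

Variable g : 'cV[R]_m.
Hypothesis g0 : 0 < dot g g.

(* P is the orthogonal projection onto the complement of g; the diagonal entries
   of P A P are nonnegative and their sum is tr A minus the Rayleigh quotient
   of A at g. *)
Let P : 'M[R]_m := 1%:M - (dot g g)^-1 *: (g *m g^T).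

Let PT : P^T = P.
Proof. by rewrite /P linearB linearZ/= trmx1 trmx_mul trmxK. Qed.

Let PP : P *m P = P.
Proof.
rewrite {1}/P mulmxBl mul1mx -scalemxAl /P mulmxBr mulmx1 -scalemxAr.
rewrite mulmxA mulmx_col_row -scalemxAl scalerA mulVf ?gt_eqF// scale1r.
by rewrite subrr scaler0 subr0.
Qed.

Let trP : \tr (P *m A *m P) = \tr A - dot g (A *m g) / dot g g.
Proof.
rewrite mxtrace_mulC mulmxA PP mxtrace_mulC /P mulmxBr mulmx1 linearB/=.
congr (_ - _); rewrite -scalemxAr mxtraceZ mulrC; congr (_ * _).
by rewrite mulmxA mxtrace_mulC trace_mx11.
Qed.

Let diagP i : (P *m A *m P) i i = dot (col i P) (A *m col i P).
Proof.
have -> : (P *m A *m P) i i = (row i P *m A *m col i P) 0 0.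
  rewrite -row_mul -[in RHS]row_mul !mxE.
  by apply: eq_bigr => k _; rewrite !mxE.
by rewrite /dot tr_col PT mulmxA.
Qed.

Lemma rayleigh_le_trace : dot g (A *m g) / dot g g <= \tr A.
Proof.
by rewrite -subr_ge0 -trP sumr_ge0// => i _; rewrite diagP.
Qed.

(** Equality makes every diagonal entry of [P *m A *m P] vanish, so [A] kills each column of [P].
    Hence [A = A g g^T / |g|^2]; inserting the transpose of this identity into it leaves a multiple
    of [g g^T]. *)
Lemma rayleigh_eq_trace : dot g (A *m g) / dot g g = \tr A ->
  A = (\tr A / dot g g) *: (g *m g^T).
Proof.
move=> trA.
have tr0 : \sum_i (P *m A *m P) i i = 0 by rewrite -/(mxtrace _) trP trA subrr.
have AP : A *m P = 0.
  apply/matrixP => i j; rewrite mxE.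
  have : A *m col j P = 0.
    apply: psd_mulmx_eq0; rewrite -diagP.
    move/psumr_eq0P : tr0; apply => // k _.
    by rewrite diagP.
  move/colP => /(_ i); rewrite !mxE => e; rewrite -[RHS]e.
  by apply: eq_bigr => k _; rewrite [in RHS]mxE.
have AE : A = (dot g g)^-1 *: (A *m g *m g^T).
  apply/eqP; rewrite -subr_eq0 -{1}(mulmx1 A) scalemxAr -mulmxA -scalemxAr.
  by rewrite -mulmxBr AP.
have AE' : A = (dot g g)^-1 *: (g *m (A *m g)^T).
  by rewrite -[LHS]symA [in LHS]AE linearZ/= trmx_mul trmxK.
rewrite {1}AE {1}AE'.
rewrite -scalemxAl mulmx_col_row -scalemxAl scalerA -scalemxAl scalerA -trA.
by rewrite [dot (A *m g) g]dotC; congr (_ *: _); ring.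
Qed.

End positive_semidefinite.

(** * The lower bound on the cost and its equality case *)

Section optimal_update.
Context {R : realType} {m : nat}.
Variables (alpha : R) (g : 'cV[R]_m) (c : R) (A : 'M[R]_m).
Hypothesis alpha0 : 0 < alpha.
Hypothesis g0 : g <> 0.
Hypothesis symA : A^T = A.
Hypothesis quad0 : forall x, 0 <= quad c (- g) A x.

Let A_psd x : 0 <= dot x (A *m x). Proof. exact: quad_ge0_psd quad0 x. Qed.

Let N := norm2 g.
Let N0 : 0 < N. Proof. exact: norm2_gt0. Qed.
Let gg0 : 0 < dot g g. Proof. by rewrite -sqr_norm2 exprn_gt0. Qed.
Let h := dot g (A *m g) / dot g g.

Let N2 : N ^+ 2 <= 4 * c * h.
Proof.
have [_] : 0 <= dot g (A *m g) /\ (- dot g g) ^+ 2 <= 4 * c * dot g (A *m g).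
  apply: ge0_quadratic_discr => t.
  have := quad0 (t *: g); rewrite /quad -scalemxAr !(dotZl, dotZr) dotNl.
  by congr (_ <= _); ring.
by rewrite sqrrN /N sqr_norm2 /h mulrA ler_pdivlMr// -expr2.
Qed.

Let htr : h <= \tr A. Proof. exact: rayleigh_le_trace. Qed.

Let le_h : alpha * N <= c + alpha ^+ 2 * h.
Proof.
have h0 : 0 <= h by rewrite mulr_ge0// invr_ge0 ltW.
have c0 : 0 <= c.
  by have := quad0 0; rewrite /quad mulmx0 !dot0r !addr0.
rewrite -(@ler_pXn2r _ 2) ?nnegrE//; last 2 first.
- by rewrite mulr_ge0 ?ltW.
- by rewrite addr_ge0// (mulr_ge0 _ h0)// sqr_ge0.
have : alpha ^+ 2 * N ^+ 2 <= alpha ^+ 2 * (4 * c * h).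
  by rewrite ler_wpM2l// sqr_ge0.
(* Arithmetic-geometric mean inequality, from [(c + alpha^2 h)^2 = (c - alpha^2 h)^2 + 4 alpha^2 c
   h]. *)
have := sqr_ge0 (c - alpha ^+ 2 * h); rewrite exprMn; nra.
Qed.

Lemma update_cost_ge : alpha * norm2 g <= c + alpha ^+ 2 * \tr A.
Proof. by apply: le_trans le_h _; rewrite lerD2l ler_wpM2l// sqr_ge0. Qed.

Lemma update_cost_min : c + alpha ^+ 2 * \tr A <= alpha * norm2 g ->
  c = alpha / 2 * norm2 g /\ A = (2 * alpha * norm2 g)^-1 *: (g *m g^T).
Proof.
move=> le_cost.
have a2 : 0 < alpha ^+ 2 by rewrite exprn_gt0.
have trh : \tr A = h.
  apply/eqP; rewrite eq_le htr andbT -(ler_pM2l a2) -(lerD2l c).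
  exact: le_trans le_cost le_h.
have hc : c + alpha ^+ 2 * h = alpha * N.
  by apply/eqP; rewrite eq_le le_h andbT -trh.
have c_h : c = alpha ^+ 2 * h.
  apply/eqP; rewrite -subr_eq0 -sqrf_eq0 eq_le sqr_ge0 andbT.
  (* As [c + alpha^2 h = alpha N], this bound says [(c - alpha^2 h)^2 <= 0]. *)
  have : alpha ^+ 2 * N ^+ 2 <= alpha ^+ 2 * (4 * c * h).
    by rewrite ler_wpM2l// ltW.
  rewrite -exprMn -hc; nra.
have cE : c = alpha / 2 * norm2 g by move: hc; rewrite -/N; lra.
split=> //.
rewrite (rayleigh_eq_trace symA A_psd gg0)// trh; congr (_ *: _).
have -> : h = norm2 g / (2 * alpha).
  apply: (mulfI (lt0r_neq0 a2)); rewrite -c_h cE; field; exact: lt0r_neq0.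
by rewrite -sqr_norm2; field; rewrite !lt0r_neq0.
Qed.

End optimal_update.

(** * Optimality and uniqueness of the rank-one update *)

Theorem theorem4p1 (R : realType) (m n : nat)
    (J : 'cV[R]_m * 'cV[R]_n -> R)
    (zstar : 'cV[R]_m) (thetabar : 'cV[R]_n) (alpha : R)
    (hJ : twice_continuously_differentiable J)
    (halpha : 0 < alpha)
    (g : 'cV[R]_m)
    (hg : g = gradient (fun z => J (z, thetabar)) zstar)
    (hg0 : g <> 0) :
  unique_global_minimizer
    [set Rt : 'cV[R]_m -> R |
      candidate_updates Rt /\
      gradient Rt zstar = - gradient (fun z => J (z, thetabar)) zstar]
    (fun Rt => L1_norm (isotropic_gaussian alpha zstar) Rt)
    (fun z => alpha / 2 * norm2 g - ((z - zstar)^T *m g) 0 0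
       + 1 / 2 * ((z - zstar)^T *m ((1 / (alpha * norm2 g)) *: (g *m g^T))
                    *m (z - zstar)) 0 0).
Proof.
rewrite -hg; set c0 := alpha / 2 * norm2 g.
have N0 := norm2_gt0 hg0.
(* The coefficient [1 / (alpha * norm2 g)] of the statement, with its outer factor 1/2 absorbed to
   match [quad]. *)
pose k : R := (2 * alpha * norm2 g)^-1.
have k0 : 0 < k by rewrite invr_gt0 !mulr_gt0.
have optE : (fun z => c0 - ((z - zstar)^T *m g) 0 0
    + 1 / 2 * ((z - zstar)^T *m ((1 / (alpha * norm2 g)) *: (g *m g^T))
                    *m (z - zstar)) 0 0) =
    (fun z => quad c0 (- g) (k *: (g *m g^T)) (z - zstar)).
  apply/funext => z; rewrite /quad dotNl [dot g _]dotC -mulmxA; congr (_ + _).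
  rewrite -/(dot _ _) -!scalemxAl !dotZr mulrA; congr (_ * _).
  by rewrite /k; field; rewrite !lt0r_neq0.
(* The claimed minimizer is a perfect square, hence nonnegative. *)
have optS z : quad c0 (- g) (k *: (g *m g^T)) z =
    k * (alpha * norm2 g - dot g z) ^+ 2.
  rewrite /quad -scalemxAl mulmx_col_row !dotZr dotNl (dotC z g) /c0 /k.
  by field; rewrite !lt0r_neq0.
have costE c b A : (forall x, 0 <= quad c b A x) ->
    L1_norm (isotropic_gaussian alpha zstar) (fun z => quad c b A (z - zstar)) =
    (c + alpha ^+ 2 * \tr A)%:E.
  move=> q0; rewrite /L1_norm Lnorm1.
  rewrite -(integral_quad_isotropic_gaussian zstar halpha q0).
  by apply: eq_integral => z _; rewrite /= ger0_norm.
have opt0 x : 0 <= quad c0 (- g) (k *: (g *m g^T)) x.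
  by rewrite optS mulr_ge0 ?sqr_ge0// ltW.
(* Both summands equal [alpha / 2 * norm2 g], so the lower bound is attained. *)
have optcost : c0 + alpha ^+ 2 * \tr (k *: (g *m g^T)) = alpha * norm2 g.
  rewrite mxtraceZ mxtrace_mulC trace_mx11 -/(dot g g) -sqr_norm2 /c0 /k.
  by field; rewrite !lt0r_neq0.
have candE Rt : candidate_updates Rt -> gradient Rt zstar = - g ->
    exists c A, [/\ A^T = A, forall x, 0 <= quad c (- g) A x &
      Rt = (fun z => quad c (- g) A (z - zstar))].
  move=> [Rt0 /(quadraticP zstar)[c [b [A [symA RtE]]]] _].
  have {}RtE : Rt = (fun z => quad c b A (z - zstar)) by apply/funext.
  rewrite RtE gradient_quad => bE; exists c, A; split => //; last by rewrite bE.
  by move=> x; have := Rt0 (x + zstar); rewrite RtE addrK bE.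
pose opt z := quad c0 (- g) (k *: (g *m g^T)) (z - zstar).
have optS1 : candidate_updates opt /\ gradient opt zstar = - g.
  split; last exact: gradient_quad.
  split; [by move=> z; exact: opt0|exact: quadratic_quad|].
  by apply: convex_quad; exact: quad_ge0_psd opt0.
rewrite optE; split => /=.
- exact: optS1.
- move=> Rt [/candE/[apply]-[c [A [symA q0 ->]]]].
  by rewrite !costE// optcost lee_fin; exact: update_cost_ge.
- move=> Rt [/candE/[apply]-[c [A [symA q0 ->]]]].
  (* Comparing a second minimizer with [opt] bounds its cost by [alpha * norm2 g], which puts it in
     the equality case. *)
  move=> /(_ _ optS1).
  rewrite !costE// optcost lee_fin.
  by move=> /(update_cost_min halpha hg0 symA q0)[-> ->].
Qed.
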